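(* Let $(H;\langle\cdot,\cdot\rangle)$ be an inner product space over $\mathbb{K}$ and let $x,y\in H$ and $M>m>0$ be such that either $$\operatorname{Re}\langle My-x,\,x-my\rangle\ge0,$$ or, equivalently, $$\left\|x-\frac{M+m}{2}\cdot y\right\|\le\frac12(M-m)\|y\|$$ holds. Then $$0\le\|x\|+\|y\|-\|x+y\|\le\frac{\sqrt M-\sqrt m}{\sqrt[4]{mM}}\sqrt{\operatorname{Re}\langle x,y\rangle} .$$
   Context: $\mathbb{K}$ is $\mathbb{R}$ or $\mathbb{C}$; $m,M$ are real numbers; $\|z\|=\sqrt{\langle z,z\rangle}$ is the norm induced by the inner product. *)

(* Defs.v *)
From HB Require Import structures.
From mathcomp Require Import all_boot all_order all_algebra.
From mathcomp Require Import complex.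
From mathcomp Require Import reals exp.

Set Implicit Arguments.
Unset Strict Implicit.
Unset Printing Implicit Defensive.
Import Order.TTheory GRing.Theory Num.Theory.
Local Open Scope ring_scope.

Variant scalar_kind := RealScalars | ComplexScalars.

Definition scalars (R : realType) (k : scalar_kind) : numFieldType :=
  match k with
  | RealScalars => R
  | ComplexScalars => R[i]
  end.

Definition scalars_conj (R : realType) (k : scalar_kind) :
    scalars R k -> scalars R k :=
  match k with
  | RealScalars => idfun
  | ComplexScalars => Num.conj : R[i] -> R[i]
  end.

Definition scalars_re (R : realType) (k : scalar_kind) : scalars R k -> R :=
  match k with
  | RealScalars => idfun
  | ComplexScalars => @complex.Re R
  end.

Definition scalars_of_real (R : realType) (k : scalar_kind) :
    R -> scalars R k :=
  match k with
  | RealScalars => idfun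
  | ComplexScalars => real_complex R
  end.

Arguments scalars_conj {R} k _.
Arguments scalars_re {R k} _.
Arguments scalars_of_real {R} k _.

(* An inner product is positive definite, conjugate-symmetric, linear in its
   first argument and conjugate-linear in its second one. *)
Notation inner_product k H := {dot H for scalars_conj k}.

(* [form z z] is a nonnegative real, as an element of [scalars R k]; [scalars_re]
   only brings it back to [R]. *)
Definition ip_norm (R : realType) (k : scalar_kind) (H : lmodType (scalars R k))
    (form : inner_product k H) (z : H) : R :=
  Num.sqrt (scalars_re (form z z)).

(* Main.v *)
Require Import Defs.
From HB Require Import structures.
From mathcomp Require Import all_boot all_order all_algebra.
From mathcomp Require Import complex.
From mathcomp Require Import reals exp.
From mathcomp Require Import ring lra.

(** Only the real part of the inner product matters: [(u, v) |-> Re <u, v>] is a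
    positive definite symmetric bilinear form over the reals, whatever the
    scalars are. Put [a = ||x||], [b = ||y||] and [r = Re <x, y>]. Expanding,
    each of the two hypotheses becomes [a ^ 2 + m M b ^ 2 <= (M + m) r] (lemmas
    [re_form_segment] and [norm_ball_segmentE]), hence they are equivalent.

    With [s = sqrt (m M)], the arithmetic-geometric mean inequality gives
    [2 s a b <= (M + m) r], a reverse of the Cauchy-Schwarz inequality, that is,
    [2 (a b - r) <= (sqrt M - sqrt m) ^ 2 / s * r]. Now
    [(a + b) ^ 2 - ||x + y|| ^ 2 = 2 (a b - r)], and the square of the deficit
    [a + b - ||x + y||] is at most this difference of squares because
    [0 <= ||x + y|| <= a + b]. The claim follows by taking square roots, since
    [s] is the square of the fourth root of [m M]. *)

Set Implicit Arguments.
Unset Strict Implicit.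
Unset Printing Implicit Defensive.
Import Order.TTheory GRing.Theory Num.Theory.
Local Open Scope ring_scope.

Section RealPart.
Variables (R : realType) (k : scalar_kind) (H : lmodType (scalars R k)).
Variable form : inner_product k H.
Implicit Types (u v w : H) (t : R).

Definition re_form u v : R := scalars_re (form u v).

Local Notation B := re_form.
Local Notation "t %:S" := (scalars_of_real k t) (at level 2, format "t %:S").

Lemma scalars_reD (a b : scalars R k) :
  scalars_re (a + b) = scalars_re a + scalars_re b.
Proof. by case: k a b => //= -[a a'] [b b']. Qed.

Lemma scalars_reZ t (a : scalars R k) :
  scalars_re (t%:S * a) = t * scalars_re a.
Proof. by case: k a => //= -[a a'] /=; rewrite mul0r subr0. Qed.

Lemma scalars_re_conj (a : scalars R k) :
  scalars_re (scalars_conj k a) = scalars_re a.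
Proof. by case: k a => //= -[a a']. Qed.

Lemma scalars_re_gt0 (a : scalars R k) : 0 < a -> 0 < scalars_re a.
Proof. by case: k a => //= -[a a']; rewrite ltcE /= => /andP[]. Qed.

Lemma re_formC u v : B u v = B v u.
Proof. by rewrite /re_form hermitian_subproof expr0 mul1r scalars_re_conj. Qed.

Lemma re_formDl u v w : B (u + v) w = B u w + B v w.
Proof. by rewrite /re_form linearDl scalars_reD. Qed.

Lemma re_formZl t u w : B (t%:S *: u) w = t * B u w.
Proof. by rewrite /re_form linearZl_LR scalars_reZ. Qed.

Lemma re_formNl u w : B (- u) w = - B u w.
Proof. by apply/eqP; rewrite -addr_eq0 -re_formDl addNr /re_form linear0l; case: k. Qed.

Lemma re_formDr u v w : B w (u + v) = B w u + B w v.
Proof. by rewrite !(re_formC w) re_formDl. Qed.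

Lemma re_formZr t u w : B w (t%:S *: u) = t * B w u.
Proof. by rewrite !(re_formC w) re_formZl. Qed.

Lemma re_formNr u w : B w (- u) = - B w u.
Proof. by rewrite !(re_formC w) re_formNl. Qed.

Definition re_formE :=
  (re_formDl, re_formDr, re_formNl, re_formNr, re_formZl, re_formZr).

Lemma re_form0l w : B 0 w = 0.
Proof. by rewrite -(subrr w) !re_formE subrr. Qed.

Lemma re_form_gt0 u : u != 0 -> 0 < B u u.
Proof. by move=> u0; exact/scalars_re_gt0/neq0_dnorm_gt0. Qed.

Lemma re_form_ge0 u : 0 <= B u u.
Proof.
have [->|/re_form_gt0/ltW//] := eqVneq u 0.
by rewrite re_form0l.
Qed.

Local Notation norm := (ip_norm form).

Lemma ip_norm_ge0 u : 0 <= norm u.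
Proof. exact: sqrtr_ge0. Qed.

Lemma ip_norm_gt0 u : u != 0 -> 0 < norm u.
Proof. by move=> /re_form_gt0; rewrite -sqrtr_gt0. Qed.

Lemma sqr_ip_norm u : norm u ^+ 2 = B u u.
Proof. by rewrite sqr_sqrtr ?re_form_ge0. Qed.

(** Cauchy-Schwarz for the real part: the square norm of
    [||v|| u - ||u|| v] is [2 ||u|| ||v|| (||u|| ||v|| - Re <u, v>)]. *)
Lemma re_form_le_norm u v : B u v <= norm u * norm v.
Proof.
have [->|/ip_norm_gt0 u0] := eqVneq u 0.
  by rewrite re_form0l mulr_ge0 ?ip_norm_ge0.
have [->|/ip_norm_gt0 v0] := eqVneq v 0.
  by rewrite re_formC re_form0l mulr_ge0 ?ip_norm_ge0.
have := re_form_ge0 ((norm v)%:S *: u - (norm u)%:S *: v).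
rewrite !re_formE -!sqr_ip_norm (re_formC v u) => sq_ge0.
rewrite -(ler_pM2l (mulr_gt0 u0 v0)).
by nra.
Qed.

Lemma sqr_ip_normD u v :
  norm (u + v) ^+ 2 = norm u ^+ 2 + 2 * B u v + norm v ^+ 2.
Proof. by rewrite !sqr_ip_norm !re_formE (re_formC v u); ring. Qed.

Lemma ip_norm_triangle u v : norm (u + v) <= norm u + norm v.
Proof.
rewrite -ler_sqr ?nnegrE ?addr_ge0 ?ip_norm_ge0 // sqr_ip_normD.
by have := re_form_le_norm u v; nra.
Qed.

(** A deficit [d = p - n] with [0 <= n <= p] has [d ^ 2 <= p ^ 2 - n ^ 2]. *)
Lemma sqr_triangle_deficit u v :
  (norm u + norm v - norm (u + v)) ^+ 2 <= 2 * (norm u * norm v - B u v).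
Proof.
have := ip_norm_triangle u v; have := sqr_ip_normD u v.
by have := ip_norm_ge0 (u + v); nra.
Qed.

Lemma re_form_segment u v (m M : R) :
  B (M%:S *: v - u) (u - m%:S *: v)
  = (M + m) * B u v - (norm u ^+ 2 + m * M * norm v ^+ 2).
Proof. by rewrite !re_formE !sqr_ip_norm (re_formC v u); ring. Qed.

(** Squaring turns the ball condition into a polynomial one, because
    [((M + m) / 2) ^ 2 - ((M - m) / 2) ^ 2 = m M]. *)
Lemma norm_ball_segmentE u v (m M : R) : m <= M ->
  (norm (u - ((M + m) / 2)%:S *: v) <= 1 / 2 * (M - m) * norm v)
  = (norm u ^+ 2 + m * M * norm v ^+ 2 <= (M + m) * B u v).
Proof.
move=> mM; have v0 := ip_norm_ge0 v.
rewrite -ler_sqr ?nnegrE ?ip_norm_ge0 //; last by apply: mulr_ge0 => //; lra.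
rewrite [X in X <= _]sqr_ip_norm !re_formE -!sqr_ip_norm (re_formC v u).
by apply/idP/idP; lra.
Qed.

(** By the arithmetic-geometric mean inequality, the sum of squares on the left
    of the hypothesis is at least [2 * sqrt (m * M) * (norm u * norm v)]. *)
Lemma reverse_Cauchy_Schwarz u v (m M : R) : 0 < m -> 0 < M ->
    norm u ^+ 2 + m * M * norm v ^+ 2 <= (M + m) * B u v ->
  2 * (norm u * norm v - B u v)
    <= (Num.sqrt M - Num.sqrt m) ^+ 2 / Num.sqrt (m * M) * B u v.
Proof.
move=> m0 M0 segment; rewrite (sqrtrM M (ltW m0)) [leRHS]mulrAC.
move: segment.
(* With [m = p ^ 2] and [M = q ^ 2] the goal becomes polynomial. *)
have := sqr_sqrtr (ltW m0); have := sqr_sqrtr (ltW M0).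
move: m0 M0; rewrite -sqrtr_gt0 -(sqrtr_gt0 M).
move: (Num.sqrt m) (Num.sqrt M) => p q p0 q0 <- <- segment.
rewrite ler_pdivlMr ?mulr_gt0 //.
by have := sqr_ge0 (norm u - p * q * norm v); lra.
Qed.

End RealPart.

Lemma sqr_powR_quarter (R : realType) (t : R) : 0 <= t ->
  (t `^ (1 / 4)) ^+ 2 = Num.sqrt t.
Proof.
move=> t0; rewrite -powR_mulrn ?powR_ge0 // -powRrM -powR12_sqrt //.
by congr (_ `^ _); field.
Qed.

Theorem proposition2 (R : realType) (k : scalar_kind)
    (H : lmodType (scalars R k)) (form : inner_product k H)
    (x y : H) (m M : R) (m_gt0 : 0 < m) (ltmM : m < M) :
  let ofR := scalars_of_real k in
  let norm := ip_norm form in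
  let condRe :=
    0 <= scalars_re (form (ofR M *: y - x) (x - ofR m *: y)) in
  let condNorm :=
    norm (x - ofR ((M + m) / 2) *: y) <= 1 / 2 * (M - m) * norm y in
  (condRe <-> condNorm) /\
  (condRe \/ condNorm ->
   0 <= norm x + norm y - norm (x + y)
     <= (Num.sqrt M - Num.sqrt m) / ((m * M) `^ (1 / 4))
        * Num.sqrt (scalars_re (form x y))).
Proof.
move=> ofR norm condRe condNorm.
have M_gt0 := lt_trans m_gt0 ltmM.
pose segment :=
  norm x ^+ 2 + m * M * norm y ^+ 2 <= (M + m) * re_form form x y.
have ReE : condRe = segment.
  by rewrite /condRe -/(re_form form _ _) re_form_segment subr_ge0.
have NormE : condNorm = segment.
  by rewrite /condNorm norm_ball_segmentE // ltW.
rewrite ReE NormE; split=> // seg.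
have {}seg : segment by case: seg.
rewrite subr_ge0 ip_norm_triangle /=.
have mM_gt0 : 0 < m * M by exact: mulr_gt0.
have reverse_CS := reverse_Cauchy_Schwarz m_gt0 M_gt0 seg.
have r_ge0 : 0 <= re_form form x y.
  rewrite -(pmulr_rge0 _ (addr_gt0 M_gt0 m_gt0)).
  by apply: le_trans seg; rewrite addr_ge0 ?sqr_ge0 // mulr_ge0 ?sqr_ge0 ?ltW.
have coef_ge0 : 0 <= (Num.sqrt M - Num.sqrt m) / (m * M) `^ (1 / 4).
  by rewrite divr_ge0 ?powR_ge0 // subr_ge0 ler_sqrt ltW.
rewrite -/(re_form form x y) -ler_sqr ?nnegrE; first last.
- by rewrite mulr_ge0 ?sqrtr_ge0.
- by rewrite subr_ge0 ip_norm_triangle.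
rewrite exprMn expr_div_n (sqr_powR_quarter (ltW mM_gt0)) (sqr_sqrtr r_ge0).
exact: le_trans (sqr_triangle_deficit form x y) reverse_CS.
Qed.
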